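(* Assume that $\rho$, $\sec\theta$ and $\sec\theta_{\rm zs}$ are constants, and $\theta,\theta_{\rm zs}<\frac\pi2$. Then: (1) $\textsc{InelasDemAlloc}_{\sf C}$ is a $\frac{1}{O(\log n)}$-approximation for $\textsc{sMaxOPF}_{\sf C}$; (2) $\textsc{InelasDemAlloc}_{\sf V}$ is a $\frac{1}{O(\eta\log n)}$-approximation for $\textsc{sMaxOPF}_{\sf V}$; (3) $\textsc{InelasDemAlloc}$ is a $\frac{1}{O(\eta\log n)}$-approximation for $\textsc{sMaxOPF}$.
   Context: Rooted tree $\mathcal G=(\mathcal V,\mathcal E)$ with root $0$; each edge $e$ has impedance $z_e\in\mathbb C$ with $\mathrm{Re}(z_e)=z_e^{\rm R}>0$, $\mathrm{Im}(z_e)=z_e^{\rm I}>0$. Customers $\mathcal N$ ($n=|\mathcal N|$) are attached to non-root nodes; customer $k$ has inelastic demand $s_k\in\mathbb C$ (parts $s_k^{\rm R},s_k^{\rm I}$), utility $u_k>0$, decision $x_k\in\{0,1\}$. $P_e$: edges on the path from edge $e$ (inclusive) to the root; $P_k$: edges on the path from customer $k$'s node to the root. Given nonnegative reals $\hat C_e$ and a real $\overline V$. Constraints: (C) $\big|\sum_{k:e\in P_k}s_kx_k\big|\le\hat C_e$ for all $e$; (V) $\sum_{k}\big(\sum_{e'\in P_k\cap P_e}(z^{\rm R}_{e'}s_k^{\rm R}+z^{\rm I}_{e'}s_k^{\rm I})\big)x_k\le\overline V$ for all $e$. $\textsc{sMaxOPF}$ maximizes $\sum_ku_kx_k$ over $x\in\{0,1\}^{\mathcal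 N}$ subject to (C),(V); $\textsc{sMaxOPF}_{\sf C}$ uses only (C); $\textsc{sMaxOPF}_{\sf V}$ only (V). $\textsc{GreedyAlloc}$ on a customer set $\hat{\mathcal N}$: sort $\hat{\mathcal N}$ by nondecreasing $|s_k|$, start with $M=\varnothing$, and add each customer $k$ in turn to $M$ if $M\cup\{k\}$ (all served) satisfies the constraints of the problem variant; return $M$. $\textsc{InelasDemAlloc}$ (resp. ${}_{\sf C}$, ${}_{\sf V}$): let $u_{\max}=\max_ku_k$, $L=u_{\max}/n^2$, $\bar u_k=\lfloor u_k/L\rfloor$; let $\hat{\mathcal N}_1=\{k:\bar u_k\in[0,2)\}$ and $\hat{\mathcal N}_i=\{k:\bar u_k\in[2^{i-1},2^i)\}$ for $i=2,\dots,\lceil2\log_2n\rceil+1$; run $\textsc{GreedyAlloc}$ for the corresponding variant ($\textsc{sMaxOPF}$, resp. $\textsc{sMaxOPF}_{\sf C}$, $\textsc{sMaxOPF}_{\sf V}$) on each $\hat{\mathcal N}_i$ to get $M_i$; return the $M_i$ of maximum total utility. A $\gamma$-approximation returns a feasible solution with utility at least $\gamma$ times the optimum. Parameters: $\theta=\max_{k,k'}|\arg(s_k)-\arg(s_{k'})|$; $\theta_{\rm zs}=\max_{k,e\in P_k}|\arg(s_k)-\arg(z_e)|$; $\eta=\max_e|P_e|$; $\rho=\max_{\tilde e}\max_{e,e'\in P_{\tilde e}}|z_e|/|z_{e'}|$.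
   Formalization: Each part additionally assumes u_max ≤ the optimum of that variant (true if every customer can be served alone), since otherwise infeasible customers with huge utility make the ratio unbounded; also n ≥ 2, because log 1 = 0. *)

(* Defs.v *)
From HB Require Import structures.
From mathcomp Require Import all_boot all_order all_algebra.
From mathcomp Require Import complex.
From mathcomp Require Import reals exp trigo.

Set Implicit Arguments.
Unset Strict Implicit.
Unset Printing Implicit Defensive.

Import Order.TTheory GRing.Theory Num.Theory.
Local Open Scope ring_scope.
Local Open Scope complex_scope.

(* Real-valued modulus; the library's `|s| on R[i] is R[i]-valued. *)
Notation cmod := (@ComplexField.Normc.normc _).

(* Principal argument, in ]-pi, pi]; arg 0 = 0 by convention. *)
Definition carg (R : realType) (s : R[i]) : R :=
  if s == 0 then 0
  else if 0 <= complex.Im s then acos (complex.Re s / cmod s)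
  else - acos (complex.Re s / cmod s).

Lemma carg_polar (R : realType) (s : R[i]) :
  s = (cmod s * cos (carg s)) +i* (cmod s * sin (carg s)).
Proof.
rewrite /carg; case: eqP => [-> | /eqP s0].
  by rewrite ComplexField.Normc.normc0 !mul0r.
have n0 : cmod s != 0.
  by apply: contra s0 => /eqP/ComplexField.Normc.eq0_normc ->.
have np : 0 < cmod s.
  by rewrite lt_neqAle eq_sym n0 /=; case: (s) => a b; apply: sqrtr_ge0.
have nE : cmod s ^+ 2 = complex.Re s ^+ 2 + complex.Im s ^+ 2.
  by case: (s) => a b /=; rewrite sqr_sqrtr // addr_ge0 ?sqr_ge0.
have bnd : -1 <= complex.Re s / cmod s <= 1.
  rewrite -ler_norml -(@ler_pXn2r _ 2) ?nnegrE // expr1n real_normK ?num_real //.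
  by rewrite expr_div_n ler_pdivrMr ?exprn_gt0 // mul1r nE lerDl sqr_ge0.
have sE : Num.sqrt (1 - (complex.Re s / cmod s) ^+ 2)
          = `|complex.Im s| / cmod s.
  have -> : 1 - (complex.Re s / cmod s) ^+ 2 = (complex.Im s / cmod s) ^+ 2.
    rewrite !expr_div_n -[1](divff (expf_neq0 2 n0)) -mulrBl {1}nE.
    by rewrite addrC addKr.
  by rewrite sqrtr_sqr normrM normfV (gtr0_norm np).
case: ifPn => im; rewrite ?cosN ?sinN acosK ?in_itv //= sin_acos // sE.
  by rewrite ger0_norm // ![cmod s * _]mulrC !divfK //; case: (s).
rewrite ltr0_norm ?ltNge // mulNr opprK ![cmod s * _]mulrC !divfK //.
by case: (s).
Qed.

Definition sec (R : realType) (t : R) : R := (cos t)^-1.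

(* The rooted tree is given by its parent map: the root is its own parent and
   every node reaches it by iterating the map.  A non-root node e also stands
   for the edge joining e to [parent e], so edges are the nodes e != root_node
   and the values of [imp] and [cap] at the root are irrelevant. *)
Record instance (R : realType) : Type := Instance {
  node : finType;
  root_node : node;
  parent : node -> node;
  parent_root : parent root_node = root_node;
  parent_connected : forall v, fconnect parent v root_node;
  imp : node -> R[i];
  imp_Re_gt0 : forall e, e != root_node -> 0 < complex.Re (imp e);
  imp_Im_gt0 : forall e, e != root_node -> 0 < complex.Im (imp e);
  customer : finType;
  loc : customer -> node;
  loc_neq_root : forall k, loc k != root_node;
  dem : customer -> R[i];
  util : customer -> R;
  util_gt0 : forall k, 0 < util k;
  cap : node -> R;
  cap_ge0 : forall e, e != root_node -> 0 <= cap e;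
  vbar : R
}.
Arguments root_node {R} i.
Arguments customer {R} i.
Arguments vbar {R} i.

Section Problem.
Variables (R : realType) (I : instance R).
Implicit Types (M A : {set customer I}) (k : customer I) (e v : node I).

Definition ncust : nat := #|customer I|.

(* Edges on the path from the node v to the root; for an edge e this is the
   path from e, inclusive. *)
Definition epath v : {set node I} :=
  [set e | (e != root_node I) && fconnect (@parent R I) v e].

Definition cpath k : {set node I} := epath (loc k).

(* A vector x in {0,1}^N is represented by the set M of served customers. *)
Definition capacity_ok M : bool :=
  [forall e, (e != root_node I) ==>
    (cmod (\sum_(k in M | e \in cpath k) dem k) <= cap e)].

Definition voltage_ok M : bool :=
  [forall e, (e != root_node I) ==>
    (\sum_(k in M) \sum_(e' in cpath k :&: epath e)
        (complex.Re (imp e') * complex.Re (dem k)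
         + complex.Im (imp e') * complex.Im (dem k)) <= vbar I)].

Definition both_ok M : bool := capacity_ok M && voltage_ok M.

Definition utility M : R := \sum_(k in M) util k.

(* Utilities are positive, so the default value 0 matters only when no set is
   feasible. *)
Definition opt (feas : pred {set customer I}) : R :=
  \big[Num.max/0]_(M : {set customer I} | feas M) utility M.

Definition greedy (feas : pred {set customer I}) (s : seq (customer I)) :
    {set customer I} :=
  foldl (fun M k => if feas (k |: M) then k |: M else M) set0 s.

(* The algorithms are rendered by the relation between input and possible
   outputs, which leaves ties (equal moduli, equal utilities) unresolved. *)
Definition greedy_alloc (feas : pred {set customer I}) A M : Prop :=
  exists s : seq (customer I),
    [/\ perm_eq s (enum A),
        sorted (fun k k' => cmod (dem k) <= cmod (dem k')) s
      & M = greedy feas s].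

(* The maximum ranges over all customers, served or not.  When umax exceeds the
   optimum, because of customers that are infeasible even alone, the rounding
   by [uscale] can put all servable customers in one class and the greedy
   choice there has no bounded ratio; approximation results thus need
   umax <= opt, which holds e.g. if every customer can be served alone. *)
Definition umax : R := \big[Num.max/0]_(k : customer I) util k.

Definition uscale : R := umax / ncust%:R ^+ 2.

Definition ubar k : int := Num.floor (util k / uscale).

Definition uclass (i : nat) : {set customer I} :=
  if i == 1%N then [set k | 0 <= ubar k < 2]
  else [set k | 2 ^+ i.-1 <= ubar k < 2 ^+ i].

Definition class_index (i : nat) : Prop :=
  (1 <= i)%N /\ i%:Z <= Num.ceil (2 * (ln ncust%:R / ln 2) : R) + 1.

Definition inelas_dem_alloc (feas : pred {set customer I}) M : Prop :=
  exists (Ms : nat -> {set customer I}) (i : nat),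
    [/\ forall j, class_index j -> greedy_alloc feas (uclass j) (Ms j),
        class_index i,
        forall j, class_index j -> utility (Ms j) <= utility (Ms i)
      & M = Ms i].

Definition approximates (gamma : R) (feas : pred {set customer I})
    (alg : {set customer I} -> Prop) : Prop :=
  forall M, alg M -> feas M /\ gamma * opt feas <= utility M.

Definition theta : R :=
  \big[Num.max/0]_(k : customer I) \big[Num.max/0]_(k' : customer I)
    `|carg (dem k) - carg (dem k')|.

Definition theta_zs : R :=
  \big[Num.max/0]_(k : customer I) \big[Num.max/0]_(e in cpath k)
    `|carg (dem k) - carg (imp e)|.

Definition eta_len : nat := \max_(e | e != root_node I) #|epath e|.

Definition rho : R :=
  \big[Num.max/0]_(e0 | e0 != root_node I)
    \big[Num.max/0]_(e in epath e0) \big[Num.max/0]_(e' in epath e0)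
      (cmod (imp e) / cmod (imp e')).

End Problem.

(* Main.v *)
Require Import Defs.
From HB Require Import structures.
From mathcomp Require Import all_boot all_order all_algebra.
From mathcomp Require Import complex.
From mathcomp Require Import reals exp trigo.
From mathcomp Require Import zify ring lra.

Import Order.TTheory GRing.Theory Num.Theory.
Local Open Scope ring_scope.

(* A customer k of a feasible set P that the greedy algorithm rejects is
   "blocked" under some edge e above k: the demands |s_j| of the rest of P below
   e add up to less than c times those of the customers accepted so far below e.
   For a capacity constraint c = sec theta (project on the direction of s_k); for
   a voltage constraint e can be taken at the root, with
   c = eta * rho * sec theta_zs.  The sets of customers below the edges form a
   laminar family, and for laminar families blocking implies that, in each
   utility class, P has at most 3c times as many customers as the greedy
   solution.  In a class of index at least 2 the utilities agree up to a factor
   2, there are at most 3 log2 n such classes, and the first class is worth at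
   most u_max / 2 <= OPT / 2. *)

(** * Greedy choice against a laminar family of sets *)

Section LaminarGreedy.
Set Implicit Arguments.
Unset Strict Implicit.
Variables (R : realFieldType) (T : finType) (p : T -> nat) (d : T -> R).
Hypothesis d_ge0 : forall k, 0 <= d k.

(** [p] is the position in the greedy order, so [upto M (p k)] is what has been accepted when [k]
    comes up. *)
Definition upto (A : {set T}) (t : nat) : {set T} := [set k in A | (p k < t)%N].

Lemma uptoS (A : {set T}) (s t : nat) : (s <= t)%N -> upto A s \subset upto A t.
Proof.
move=> st; apply/subsetP => k; rewrite !inE => /andP[-> ks] /=.
exact: leq_trans st.
Qed.

Definition mass (A : {set T}) : R := \sum_(k in A) d k.

Lemma mass_ge0 (A : {set T}) : 0 <= mass A.
Proof. exact: sumr_ge0. Qed.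

Lemma mass_sub (A B : {set T}) : A \subset B -> mass A <= mass B.
Proof.
move=> sAB; rewrite /mass [leRHS](big_setID A) /= (setIidPr sAB) lerDl.
exact: sumr_ge0.
Qed.

Lemma mass_ge (A : {set T}) k : k \in A -> d k <= mass A.
Proof. by move=> kA; rewrite /mass (big_setD1 k) //= lerDl sumr_ge0. Qed.

Lemma sum_gap (A : {set T}) (x : R) :
  \sum_(k in A) (x - d k) = x * #|A|%:R - mass A.
Proof. by rewrite sumrB sumr_const mulr_natr. Qed.

(* Abel summation: domination of all the prefix cardinalities passes to sums of
   the decreasing weights [x - d]. *)
Lemma sum_gap_dominated (A B : {set T}) (a x : R) (t : nat) :
    {in A :|: B &, forall j k, (p j <= p k)%N -> d j <= d k} ->
    (forall k, k \in A :|: B -> (p k < t)%N -> d k <= x) ->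
    (forall s, (s <= t)%N -> #|upto A s|%:R <= a * #|upto B s|%:R) ->
  \sum_(k in upto A t) (x - d k) <= a * \sum_(k in upto B t) (x - d k).
Proof.
move=> mono; elim: t x => [|t IH] x dx dom.
  rewrite !big1 ?mulr0 // => k; by rewrite !inE ltn0 andbF.
have dom' s : (s <= t)%N -> #|upto A s|%:R <= a * #|upto B s|%:R.
  by move=> st; apply: dom; apply: leqW.
case: (pickP (fun k => (k \in A :|: B) && (p k == t))) => [k /andP[kAB /eqP pk]|no].
  (* The bound [x] is lowered to [d k], where the induction hypothesis takes over; elements tied
     with [k] at position [t] have the same [d], hence gap 0. *)
  have last (C : {set T}) : C \subset A :|: B ->
      \sum_(j in upto C t.+1) (x - d j)
      = (x - d k) * #|upto C t.+1|%:R + \sum_(j in upto C t) (d k - d j).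
    move=> sC; have -> : \sum_(j in upto C t) (d k - d j)
                   = \sum_(j in upto C t.+1) (d k - d j).
      rewrite [RHS](big_setID (upto C t)) /= (setIidPr (uptoS _ (leqnSn t))).
      rewrite [X in _ + X]big1 ?addr0 // => j; rewrite !inE ltnS.
      case/andP; rewrite negb_and -leqNgt => h /andP[jC jt]; move: h; rewrite jC /= => tj.
      have jAB := subsetP sC _ jC.
      have e : p j = p k by apply/eqP; rewrite pk eqn_leq jt tj.
      by apply/eqP; rewrite subr_eq0 eq_le !mono // e.
    by rewrite !sum_gap; ring.
  rewrite !last ?subsetUl ?subsetUr // mulrDr; apply: lerD; last first.
    by apply: IH => // j jAB jt; apply: mono => //; rewrite pk ltnW.
  rewrite mulrCA ler_wpM2l ?dom // subr_ge0 dx // pk //.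
have same (C : {set T}) : C \subset A :|: B -> upto C t.+1 = upto C t.
  move=> sC; apply/setP => j; rewrite !inE ltnS leq_eqVlt andb_orr.
  case: (boolP (j \in C)) => //= jC; move: (no j); rewrite /= (subsetP sC) //= => -> //.
rewrite !same ?subsetUl ?subsetUr //; apply: IH => // j jAB jt; apply: dx => //.
exact: ltnW.
Qed.

Variables (F : {set {set T}}) (O M : {set T}) (c : R).
Hypothesis laminar : {in F &, forall X Y : {set T},
  [|| X \subset Y, Y \subset X | [disjoint X & Y]]}.
Hypothesis d_mono : {in O :|: M &, forall j k, (p j <= p k)%N -> d j <= d k}.
Hypothesis c_ge1 : 1 <= c.

Definition blocked_in (k : T) (X : {set T}) : bool :=
  [&& X \in F, k \in O, k \in X &
      mass ((O :&: X) :\ k) < c * mass (upto M (p k) :&: X)].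

Hypothesis rejected : forall k, k \in O -> k \notin M -> exists X, blocked_in k X.

Definition closed_at (t : nat) (X : {set T}) : bool :=
  [exists k, (p k < t)%N && blocked_in k X].

Lemma closed_inF t X : closed_at t X -> X \in F.
Proof. by case/existsP => k /andP[_ /and4P[]]. Qed.

Lemma closedS s t X : (s <= t)%N -> closed_at s X -> closed_at t X.
Proof.
move=> st /existsP[k /andP[ks b]]; apply/existsP; exists k.
by rewrite b (leq_trans ks st).
Qed.

(* The bound [#|O| <= 3 c #|M|] needs a strengthening: closing a set may cost
   one unit.  It is paid by the slack of the first alternative; the second one,
   without slack, makes [O] so heavy that no larger set can get blocked before
   [M] grows. *)
Definition charged (t : nat) (U : {set T}) : Prop :=
  (#|upto O t :&: U|%:R + 1 <= 3 * c * #|upto M t :&: U|%:R) \/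
  (#|upto O t :&: U|%:R <= 3 * c * #|upto M t :&: U|%:R /\
   c * mass (upto M t :&: U) <= mass (upto O t :&: U)).

Lemma charged_card t U :
  charged t U -> #|upto O t :&: U|%:R <= 3 * c * #|upto M t :&: U|%:R.
Proof. by case=> [|[]] //; lra. Qed.

(** Counts and masses add up over [X] and [U :\: X]. Slack in one part is slack in the whole;
    without any, the second alternatives add. *)
Lemma charged_split t (X U : {set T}) :
  X \subset U -> charged t X -> charged t (U :\: X) -> charged t U.
Proof.
move=> sXU; rewrite /charged.
have cards (A : {set T}) : #|A :&: U|%:R = #|A :&: X|%:R + #|A :&: (U :\: X)|%:R :> R.
  by rewrite -natrD -(cardsID X (A :&: U)) -setIA (setIidPr sXU) setIDA.
have masses (A : {set T}) : mass (A :&: U) = mass (A :&: X) + mass (A :&: (U :\: X)).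
  by rewrite {1}/mass (big_setID X) /= -setIA (setIidPr sXU) -setIDA.
rewrite !cards !masses !mulrDr.
by move=> [h1|[h1 h1']] [h2|[h2 h2']]; [left|left|left|right]; try split; lra.
Qed.

(** Such sets can be cut into maximal closed sets and single points, which is how the induction
    proceeds. *)
Definition saturated (t : nat) (U : {set T}) : Prop :=
  forall X, closed_at t X -> ~~ [disjoint X & U] -> X \subset U.

(** Let [k] be the first customer blocked in [X]. Up to position [p k] the set is open, hence
    charged; Abel summation at level [d k] turns these prefix counts into an inequality between
    gaps, and blocking turns that into a count at time [t]. *)
Lemma charged_closed t X :
    closed_at t X -> (forall s, (s < t)%N -> ~~ closed_at s X -> charged s X) ->
  charged t X.
Proof.
case/existsP=> k0 bk0 chargedX.
case: (@arg_minnP T k0 (fun k => (p k < t)%N && blocked_in k X) p bk0)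
  => k /andP[kt /and4P[XF kO kX light]] kmin {k0 bk0}.
set t0 := p k in light kt *.
have open s : (s <= t0)%N -> ~~ closed_at s X.
  move=> st; apply/existsP => -[j /andP[js bj]].
  have jt : (p j < t)%N by exact: leq_ltn_trans (ltnW (leq_trans js st)) kt.
  by have := kmin j; rewrite jt bj leqNgt (leq_trans js st) => /(_ isT).
have chargedX0 s : (s <= t0)%N -> charged s X.
  by move=> st; apply: chargedX; [apply: leq_ltn_trans kt|apply: open].
set Ot := upto O t :&: X; set O' := Ot :\ k.
set O0 := upto O t0 :&: X; set M0 := upto M t0 :&: X in light *.
have kOt : k \in Ot by rewrite !inE kO kt.
have O'X : O' \subset (O :&: X) :\ k.
  by apply: setSD; apply: setSI; apply/subsetP => j; rewrite inE => /andP[].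
have O0O' : O0 \subset O'.
  apply/subsetP => j; rewrite !inE -!andbA => /and3P[-> jt ->].
  rewrite (leq_trans jt (ltnW kt)) !andbT.
  by apply: contraTneq jt => ->; rewrite ltnn.
have M0Mt : M0 \subset upto M t :&: X by apply: setSI; apply: uptoS; apply: ltnW.
have cardOt : #|Ot|%:R = 1 + #|O'|%:R :> R by rewrite (cardsD1 k) kOt natrD.
have lightO' : mass O' < c * mass M0 by apply: le_lt_trans light; apply: mass_sub.
have massM0 : mass M0 <= d k * #|M0|%:R.
  rewrite mulr_natr -sumr_const; apply: ler_sum => m; rewrite !inE -andbA.
  by case/and3P=> mM mk _; apply: d_mono; rewrite ?inE ?mM ?kO ?orbT // ltnW.
have c1 := c_ge1.
have cgt0 : 0 < c by lra.
have massM0_gt0 : 0 < mass M0.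
  rewrite -(pmulr_rgt0 _ cgt0); exact: le_lt_trans (mass_ge0 _) lightO'.
have dk_gt0 : 0 < d k.
  rewrite lt_neqAle d_ge0 eq_sym andbT; apply: contraTneq massM0 => ->.
  by rewrite mul0r -ltNge.
have late j : j \in O' -> j \notin O0 -> d k <= d j.
  rewrite !inE -!andbA => /and4P[_ jO _ jX]; rewrite jO jX andbT /= -leqNgt => tj.
  by apply: d_mono; rewrite ?inE ?kO ?jO.
(* Customers of [O'] outside [O0] do not come before [k], so their gaps are nonpositive. *)
have gapO' : \sum_(j in O') (d k - d j) <= \sum_(j in O0) (d k - d j).
  rewrite [leLHS](big_setID O0) /= (setIidPr O0O') gerDl.
  by apply: sumr_le0 => j /setDP[jO' jO0]; rewrite subr_le0 late.
have gapO0 : \sum_(j in O0) (d k - d j) <= 3 * c * \sum_(j in M0) (d k - d j).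
  have restr (A : {set T}) s : upto A s :&: X = upto (A :&: X) s.
    by apply/setP => j; rewrite !inE -!andbA [(_ < _)%N && _]andbC.
  rewrite /O0 /M0 !restr; apply: sum_gap_dominated.
  - by rewrite -setIUl => i j /setIP[iOM _] /setIP[jOM _]; apply: d_mono.
  - rewrite -setIUl => j /setIP[jOM _] jt; apply: d_mono => //; last exact: ltnW.
    by rewrite inE kO.
  - by move=> s st; rewrite -!restr; apply: charged_card; apply: chargedX0.
move: gapO0 gapO' => /[swap] /le_trans /[apply].
rewrite !sum_gap => gap.
(* The 3 of [charged] is spent here: one [c * mass M0] absorbs [mass O'], the other two pay for [k]
   and for a unit of slack when [d k <= c * mass M0]. *)
have main : d k * #|O'|%:R < d k * (3 * c * #|M0|%:R) - 2 * (c * mass M0) by lra.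
have [heavy|lightM0] := lerP (d k) (c * mass M0).
  left; rewrite -/Ot cardOt.
  apply: le_trans (_ : 3 * c * #|M0|%:R <= _); last first.
    by rewrite ler_wpM2l ?ler_nat ?subset_leq_card //; lra.
  rewrite -(ler_pM2l dk_gt0); lra.
(* If [M] has gained a member of [X] since [t0], its [3 * c] units pay for [k] and for the slack. *)
have [MtM0|MtM0] := eqVneq (upto M t :&: X) M0; last first.
  have lt : (#|M0| + 1)%N%:R <= #|upto M t :&: X|%:R :> R.
    by rewrite ler_nat addn1 proper_card // properEneq eq_sym MtM0.
  left; rewrite -/Ot cardOt.
  apply: le_trans (_ : 3 * c * (#|M0| + 1)%N%:R <= _); last first.
    by rewrite ler_wpM2l //; lra.
  have : #|O'|%:R <= 3 * c * #|M0|%:R.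
    rewrite -(ler_pM2l dk_gt0); have : 0 < c * mass M0 by rewrite mulr_gt0.
    lra.
  rewrite natrD; lra.
(* A customer of [O'] outside [O0] would alone weigh at least [d k], more than [lightO'] allows. *)
have O'E : O' = O0.
  apply/eqP; rewrite eqEsubset O0O' andbT; apply/subsetP => j jO'.
  apply: contraLR (lt_trans lightO' lightM0) => jO0; rewrite -leNgt.
  exact: le_trans (late _ jO' jO0) (mass_ge jO').
right; rewrite MtM0 -/Ot cardOt; split; last first.
  exact: le_trans (ltW lightM0) (mass_ge kOt).
(* The second alternative at [t0] contradicts [lightO']; the first pays for [k] with its slack. *)
case: (chargedX0 t0 (leqnn _)); rewrite -/O0 -/M0 O'E; first by lra.
by case=> _ /le_lt_trans; rewrite -O'E => /(_ _ lightO'); rewrite ltxx.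
Qed.

(** Induction on [t], then on the size of [U]. A point of [U] is split off with a maximal closed set
    around it, or alone if there is none; laminarity keeps the remainder saturated. *)
Lemma charged_saturated t U : saturated t U -> charged t U.
Proof.
elim/ltn_ind: t U => t IHt U.
have [n] := ubnP #|U|; elim: n U => // n IHn U; rewrite ltnS => cardU satU.
have [->|[k kU]] := set_0Vmem U.
  by right; rewrite !setI0 cards0 /mass !big_set0 !mulr0.
have cU (X : {set T}) : k \in X -> X \subset U -> (#|U :\: X| < n)%N.
  move=> kX sXU; apply: leq_trans cardU; apply: proper_card.
  apply/properP; split; first exact: subsetDl.
  by exists k; rewrite // inE kX.
case: (pickP (fun X => closed_at t X && (k \in X))) => [X0 X0P|open_k].
  have [X /maxsetP[/andP[clX kX] Xmax] _] :=
    @maxset_exists _ (fun X => closed_at t X && (k \in X)) _ X0P.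
  have maxX (Y : {set T}) : closed_at t Y -> X \subset Y -> Y = X.
    by move=> clY sXY; apply: Xmax => //; rewrite clY (subsetP sXY).
  have compX (Y : {set T}) : closed_at t Y -> ~~ [disjoint Y & X] -> Y \subset X.
    move=> clY; have := laminar (closed_inF clX) (closed_inF clY).
    case/or3P=> [sXY _|//|].
      by rewrite (maxX _ clY sXY).
    by rewrite disjoint_sym => ->.
  have sXU : X \subset U.
    by apply: satU => //; apply/pred0Pn; exists k; rewrite /= kX kU.
  apply: (charged_split (X := X)) => //.
    apply: charged_closed => // s st _; apply: IHt => // Y clY.
    by apply: compX; apply: closedS clY; apply: ltnW.
  apply: IHn; first exact: cU.
  move=> Y clY /pred0Pn[j /= /andP[jY]]; rewrite inE => /andP[jX jU].
  have YU : Y \subset U by apply: satU => //; apply/pred0Pn; exists j; rewrite /= jY.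
  rewrite subsetD YU /=; apply: contraR jX => nd.
  exact: (subsetP (compX _ clY nd)).
have k1U : [set k] \subset U by rewrite sub1set.
apply: (charged_split (X := [set k])) => //; last first.
  apply: IHn; first by apply: cU => //; rewrite inE.
  move=> Y clY /pred0Pn[j /= /andP[jY]]; rewrite inE => /andP[_ jU].
  have YU : Y \subset U by apply: satU => //; apply/pred0Pn; exists j; rewrite /= jY.
  rewrite subsetD YU disjoint_sym disjoints1.
  by have := open_k Y; rewrite clY /= => ->.
(* Lying in no closed set, [k] is either accepted, and [1 + 1 <= 3 * c], or not in [O] so far, since
   a rejected [k] would have closed a set. *)
have [kM|kM] := boolP (k \in upto M t).
  left; have -> : upto M t :&: [set k] = [set k] by apply/setIidPr; rewrite sub1set.
  have : #|upto O t :&: [set k]|%:R <= 1 :> R.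
    by rewrite -[1]/(1%:R) ler_nat -(cards1 k) subset_leq_card ?subsetIr.
  by have := c_ge1; rewrite cards1; lra.
have kO : k \notin upto O t.
  apply: contra kM; rewrite !inE => /andP[kO kt]; rewrite kt andbT.
  apply: contraT => kM.
  have [X bX] := rejected kO kM.
  have := open_k X; have /and4P[_ _ kX _] := bX.
  suff -> : closed_at t X by rewrite kX.
  by apply/existsP; exists k; rewrite kt.
have emp (A : {set T}) : k \notin A -> A :&: [set k] = set0.
  by move=> kA; apply/eqP; rewrite setI_eq0 disjoint_sym disjoints1.
by right; rewrite !emp // cards0 /mass !big_set0 !mulr0.
Qed.

Lemma laminar_greedy_card : #|O|%:R <= 3 * c * #|M|%:R.
Proof.
pose t := (\max_k p k).+1.
have full (A : {set T}) : upto A t = A.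
  by apply/setP => k; rewrite inE ltnS (leq_bigmax (F := p)) andbT.
have : charged t setT by apply: charged_saturated => X _ _; apply: subsetT.
by move/charged_card; rewrite !full !setIT.
Qed.

End LaminarGreedy.

(** * Inner products and moduli of complex numbers *)

Section Dot.
Set Implicit Arguments.
Unset Strict Implicit.
Variable R : realType.
Implicit Types (s t : R[i]) (x y : R).

(** The real part of [s] times the conjugate of [t], used for two demands as well as for an
    impedance and a demand. *)
Definition dot s t : R :=
  complex.Re s * complex.Re t + complex.Im s * complex.Im t.

Lemma dotC s t : dot s t = dot t s.
Proof. by rewrite /dot mulrC [X in _ + X]mulrC. Qed.

Lemma cmod_ge0 s : 0 <= cmod s.
Proof. by case: s => a b; apply: sqrtr_ge0. Qed.

Lemma dot_cos s t : dot s t = cmod s * cmod t * cos (carg s - carg t).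
Proof.
have polar (u : R[i]) : complex.Re u = cmod u * cos (carg u)
    /\ complex.Im u = cmod u * sin (carg u).
  by split; rewrite {1}[u]carg_polar.
have [[rs js] [rt jt]] := (polar s, polar t).
by rewrite /dot rs js rt jt cosB; ring.
Qed.

Lemma dot_le s t : dot s t <= cmod s * cmod t.
Proof. by rewrite dot_cos ler_piMr ?mulr_ge0 ?cmod_ge0 ?cos_le1. Qed.

Lemma cos_norm_le x y : `|x| <= y -> y <= pi -> cos y <= cos x.
Proof.
move=> xy ypi; rewrite -(cos_norm x) leNgt; apply/negP.
rewrite ltr_cos ?in_itv /= ?normr_ge0 ?ypi ?(le_trans xy) //.
  by rewrite ltNge xy.
by rewrite (le_trans _ xy).
Qed.

Lemma dot_ge s t x :
  `|carg s - carg t| <= x -> x <= pi -> cmod s * cmod t * cos x <= dot s t.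
Proof.
by move=> sx xpi; rewrite dot_cos ler_wpM2l ?mulr_ge0 ?cmod_ge0 ?cos_norm_le.
Qed.

Lemma dotss s : dot s s = cmod s ^+ 2.
Proof. by rewrite dot_cos subrr cos0 mulr1. Qed.

Lemma dot_suml (J : finType) (A : {set J}) (F : J -> R[i]) t :
  dot (\sum_(j in A) F j) t = \sum_(j in A) dot (F j) t.
Proof. by rewrite /dot !raddf_sum /= !mulr_suml -big_split. Qed.

Lemma cmod_sum_le (J : finType) (A : {set J}) (F : J -> R[i]) :
  cmod (\sum_(j in A) F j) <= \sum_(j in A) cmod (F j).
Proof.
elim/big_ind2: _ => [|s x t y sx ty|//]; first by rewrite ComplexField.Normc.normc0.
exact: le_trans (le_normcD _ _) (lerD sx ty).
Qed.

End Dot.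

(** * Paths to the root and the customers below an edge *)

Section Tree.
Set Implicit Arguments.
Unset Strict Implicit.
Variables (R : realType) (I : instance R).
Implicit Types (A M : {set customer I}) (k : customer I) (e f v : node I).

(** Both nodes are iterates of [parent] at [v], and the one reached in fewer steps leads to the
    other. *)
Lemma parent_connect_total v e f :
    fconnect (@parent R I) v e -> fconnect (@parent R I) v f ->
  fconnect (@parent R I) e f || fconnect (@parent R I) f e.
Proof.
move=> /iter_findex <- /iter_findex <-.
set i := findex _ _ _; set j := findex _ _ _.
wlog ij : i j / (i <= j)%N.
  by move=> h; case/orP: (leq_total i j) => /h //; rewrite orbC.
by rewrite -(subnK ij) iterD fconnect_iter.
Qed.

Lemma epath_trans v e f : e \in epath v -> f \in epath e -> f \in epath v.
Proof.
by rewrite !inE => /andP[_ ve] /andP[-> ef] /=; apply: connect_trans ef.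
Qed.

Lemma epath_refl e : e != root_node I -> e \in epath e.
Proof. by move=> er; rewrite inE er connect0. Qed.

Definition below e : {set customer I} := [set k | e \in cpath k].

Definition demand_size k : R := cmod (dem k).

Lemma demand_size_ge0 k : 0 <= demand_size k.
Proof. exact: cmod_ge0. Qed.

(** Two edges with a common customer below them lie on its path to the root, hence are
    comparable. *)
Lemma below_laminar :
  {in [set below e | e : node I] &, forall X Y : {set customer I},
     [|| X \subset Y, Y \subset X | [disjoint X & Y]]}.
Proof.
move=> _ _ /imsetP[e _ ->] /imsetP[f _ ->].
have sub e' f' : e' != root_node I -> fconnect (@parent R I) f' e' ->
    below f' \subset below e'.
  move=> er fe; apply/subsetP => k; rewrite !inE er /= => /andP[_ kf].
  exact: connect_trans fe.
case: (boolP [disjoint below e & below f]) => [|/pred0Pn[k /= /andP[]]].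
  by rewrite !orbT.
rewrite !inE => /andP[er ke] /andP[fr kf].
by case/orP: (parent_connect_total ke kf) => /sub ->; rewrite ?orbT.
Qed.

End Tree.

(** * Runs of the greedy algorithm *)

Section Greedy.
Set Implicit Arguments.
Unset Strict Implicit.
Variables (R : realType) (I : instance R) (feas : pred {set customer I}).
Implicit Types (A M : {set customer I}) (k : customer I).

Let step M k := if feas (k |: M) then k |: M else M.

Lemma foldl_step_sub M (s : seq (customer I)) :
  M \subset foldl step M s /\ {subset foldl step M s <= [predU M & s]}.
Proof.
elim: s M => [|k s IH] M /=.
  by split=> // k; rewrite !inE => ->.
have [sub sup] := IH (step M k); rewrite /step in sub sup *; split.
  by apply: subset_trans sub; case: ifP => // _; apply: subsetUr.
move=> j /sup; rewrite !inE; case: ifP => _; rewrite ?inE => /orP[|->];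
  rewrite ?orbT //; last by move=> ->.
by case/orP => ->; rewrite ?orbT.
Qed.

Lemma greedy_sub (s : seq (customer I)) : {subset greedy feas s <= s}.
Proof.
by move=> k /(proj2 (foldl_step_sub set0 s)); rewrite !inE.
Qed.

Lemma greedy_feas (s : seq (customer I)) : feas set0 -> feas (greedy feas s).
Proof.
rewrite /greedy; elim: s set0 => [|k s IH] M //= fM; apply: IH.
by case: ifP.
Qed.

(** Acceptance is never revoked and [s] has no repetition, so the accepted members of smaller index
    form exactly the set against which [k] was tested. *)
Lemma greedy_rejected (s : seq (customer I)) k :
    feas set0 -> uniq s -> k \in s -> k \notin greedy feas s ->
  let M := upto (index^~ s) (greedy feas s) (index k s) in
  feas M /\ ~~ feas (k |: M).
Proof.
move=> f0 us ks kM; move: us kM; case/splitPr: ks => s1 s2.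
rewrite uniq_catC /= mem_cat negb_or cat_uniq => /andP[/andP[ks2 ks1]].
case/and3P=> us2 dis us1.
set G := greedy feas _; set M1 := greedy feas s1.
have GE : G = foldl step (step M1 k) s2 by rewrite /G /greedy foldl_cat.
have [sub sup] := foldl_step_sub (step M1 k) s2; rewrite -GE in sub sup.
move=> kG; have rej : ~~ feas (k |: M1).
  by apply: contra kG => f1; apply: (subsetP sub); rewrite /step f1 setU11.
rewrite /step (negPf rej) in sub sup.
suff -> : upto (index^~ (s1 ++ k :: s2)) G (index k (s1 ++ k :: s2)) = M1.
  by split=> //; apply: greedy_feas.
apply/setP => m; rewrite inE !index_cat (negPf ks1) /= eqxx addn0.
have [ms1|ms1] := boolP (m \in s1).
  rewrite index_mem ms1 andbT; apply/idP/idP => [/sup|/(subsetP sub)//].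
  rewrite !inE => /orP[//|ms2]; case/negP: dis; apply/hasP; by exists m.
rewrite ltnNge leq_addr andbF; apply/esym/negbTE; apply: contra ms1.
exact: greedy_sub.
Qed.

Variable c : R.
Hypothesis c_ge1 : 1 <= c.
Hypothesis feas0 : feas set0.
(** The link between the constraints and the counting argument; each variant supplies its own
    [c]. *)
Hypothesis blocks : forall A M k,
  feas A -> feas M -> k \in A -> ~~ feas (k |: M) ->
  exists e : node I, k \in below e /\
    mass (@demand_size R I) ((A :&: below e) :\ k)
    < c * mass (@demand_size R I) (M :&: below e).

Lemma greedy_alloc_card A M P :
  greedy_alloc feas A M -> feas P -> #|P :&: A|%:R <= 3 * c * #|M|%:R :> R.
Proof.
case=> s [ps srt ->] fP.
have us : uniq s by rewrite (perm_uniq ps) enum_uniq.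
have sA k : (k \in s) = (k \in A) by rewrite (perm_mem ps) mem_enum.
apply: (@laminar_greedy_card R _ (index^~ s) (@demand_size R I)
          (@demand_size_ge0 R I) [set below e | e : node I]) => //.
- exact: below_laminar.
- have inS k : k \in P :&: A :|: greedy feas s -> k \in s.
    by rewrite !inE => /orP[/andP[_]|/greedy_sub //]; rewrite sA.
  pose le k k' : bool := demand_size k <= demand_size k'.
  have le_tr : transitive le by move=> ? ? ?; apply: le_trans.
  have le_refl : reflexive le by move=> ?; apply: lexx.
  by move=> j k /inS js /inS ks; apply: (sorted_leq_index le_tr le_refl srt).
- move=> k /[dup] kPA /setIP[kP kA] kM.
  have ks : k \in s by rewrite sA.
  have [fM nf] := greedy_rejected feas0 us ks kM.
  (* [blocks] is applied to all of [P], which is known to be feasible; restricting to the class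
     afterwards only lowers the left mass. *)
  have [e [ke lt]] := blocks fP fM kP nf.
  exists (below e); rewrite /blocked_in imset_f // kPA ke /=.
  apply: le_lt_trans lt; apply: (mass_sub (@demand_size_ge0 R I)).
  by apply: setSD; apply: setSI; apply: subsetIl.
Qed.

(** * Utility classes and the approximation ratio *)

Hypothesis n_gt1 : (1 < ncust I)%N.
Let n : R := (ncust I)%:R.
Let L : R := uscale I.
(** The class of [k] is [(level k).+1]: [trunc_log 2] is 0 at both 0 and 1, as the first class
    requires. *)
Let level k : nat := trunc_log 2 `|ubar k|.
Let N : nat := `|Num.ceil (2 * (ln n / ln 2) : R)|%N.

Let n_ge2 : 2 <= n. Proof. by rewrite ler_nat. Qed.

Lemma util_le_umax k : util k <= umax I.
Proof. exact: le_bigmax. Qed.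

Lemma sum_util_le (Q : pred (customer I)) A :
  (forall k, Q k -> k \in A) -> \sum_(k | Q k) util k <= utility A.
Proof.
move=> QA; rewrite /utility [leRHS](bigID Q) /= ler_wpDr //.
  by apply: sumr_ge0 => k _; rewrite ltW ?util_gt0.
rewrite le_eqVlt (eq_bigl Q) ?eqxx // => k.
by case: (boolP (Q k)) => [/QA ->|]; rewrite ?andbF.
Qed.

Lemma umax_gt0 : 0 < umax I.
Proof.
have /card_gt0P[k _] : (0 < #|customer I|)%N by apply: ltnW.
exact: lt_le_trans (util_gt0 k) (util_le_umax k).
Qed.

Lemma uscale_gt0 : 0 < L.
Proof. by rewrite /L /uscale divr_gt0 ?umax_gt0 // exprn_gt0 // (lt_le_trans _ n_ge2). Qed.

Lemma ubar_ge0 k : 0 <= ubar k.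
Proof. by rewrite /ubar floor_ge0 divr_ge0 ?ltW ?util_gt0 ?uscale_gt0. Qed.

Lemma util_lt_uclass i k : (0 < i)%N -> k \in uclass I i -> util k < 2 ^+ i * L.
Proof.
move=> i0; rewrite -ltr_pdivrMr ?uscale_gt0 // /uclass.
have fl : ubar k < 2 ^+ i -> util k / L < 2 ^+ i.
  by rewrite /ubar floor_lt_int rmorphXn.
by case: eqP fl => [->|_] fl; rewrite inE => /andP[_ /fl].
Qed.

Lemma util_ge_uclass i k : (1 < i)%N -> k \in uclass I i -> 2 ^+ i.-1 * L <= util k.
Proof.
move=> i1; rewrite -ler_pdivlMr ?uscale_gt0 // /uclass.
rewrite gtn_eqF // inE => /andP[+ _].
by rewrite /ubar floor_ge_int rmorphXn.
Qed.

Lemma level_uclass k : k \in uclass I (level k).+1.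
Proof.
have uE : ubar k = `|ubar k|%N by rewrite gez0_abs ?ubar_ge0.
rewrite /uclass eqSS /level; case: eqP => [l0|/eqP l0]; rewrite inE /=.
  have := ubar_ge0 k; have := trunc_log_ltn `|ubar k| (isT : 1 < 2)%N.
  by rewrite l0 expn1; lia.
have b0 : (0 < `|ubar k|)%N.
  by apply: contraNltn l0; rewrite leqn0 => /eqP ->.
have /andP[lo hi] := trunc_log_bounds (isT : 1 < 2)%N b0.
move: lo hi; set b := `|ubar k|%N => lo hi; rewrite uE -/b -!natrX !natz.
by rewrite lez_nat ltz_nat lo.
Qed.

Lemma ln2_gt0 : 0 < ln 2 :> R.
Proof. by rewrite ln_gt0 // ltr1n. Qed.

Lemma nb_levelsE : N%:Z = Num.ceil (2 * (ln n / ln 2) : R).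
Proof.
rewrite /N gez0_abs // ceil_ge0; apply: (lt_le_trans (y := 0)); first by rewrite ltrN10.
by rewrite mulr_ge0 // divr_ge0 ?ltW ?ln2_gt0 // ln_gt0 // (lt_le_trans _ n_ge2) ?ltr1n.
Qed.

(** Since [umax I] is [n ^+ 2 * L], the rounded utility is at most [n ^+ 2], whence
    [2 ^ level k <= n ^+ 2]. *)
Lemma level_le k : (level k <= N)%N.
Proof.
have [->//|l0] := posnP (level k).
have b0 : (0 < `|ubar k|)%N.
  by apply: contraTltn l0; rewrite leqn0 /level => /eqP ->.
have lo : ((2 ^ level k)%N%:R <= n ^+ 2).
  apply: le_trans (_ : `|ubar k|%N%:R <= _); first by rewrite ler_nat trunc_logP.
  have -> : `|ubar k|%N%:R = (ubar k)%:~R :> R by rewrite pmulrn gez0_abs ?ubar_ge0.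
  apply: (le_trans (floor_le _)); rewrite ler_pdivrMr ?uscale_gt0 //.
  rewrite /uscale mulrCA divff ?mulr1 ?util_le_umax //.
  by rewrite expf_neq0 // pnatr_eq0 -lt0n ltnW.
have n0 : 0 < n by exact: lt_le_trans n_ge2.
rewrite -(ler_nat R) [N%:R]pmulrn nb_levelsE; apply: le_trans (ceil_ge _).
rewrite mulrA ler_pdivlMr ?ln2_gt0 // mulrC [_ * ln n]mulrC !mulr_natr.
rewrite -(lnXn _ n0) -lnXn ?ltr0n // ler_ln ?posrE ?exprn_gt0 //.
by move: lo; rewrite natrX.
Qed.

(** The ceiling adds less than 1, and [1 <= ln n / ln 2] as [n] is at least 2. *)
Lemma nb_levels_le : N%:R <= 3 * (ln n / ln 2).
Proof.
have l2 := ln2_gt0.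
have : 1 <= ln n / ln 2.
  by rewrite ler_pdivlMr // mul1r ler_ln ?posrE // (lt_le_trans _ n_ge2).
have /andP[+ _] := ceil_itv (2 * (ln n / ln 2) : R).
rewrite -nb_levelsE intrD -pmulrn; lra.
Qed.

(** Members are worth less than [2 * L], while [umax I = n ^+ 2 * L >= 4 * L]; so some customer is
    outside the class, and [2 * L * (n - 1) <= n ^+ 2 * L / 2] because [(n - 2) ^+ 2 >= 0]. *)
Lemma uclass1_utility : utility (uclass I 1) <= umax I / 2.
Proof.
have L0 := uscale_gt0; have u0 := umax_gt0; have n2 := n_ge2.
have LE : umax I = n ^+ 2 * L.
  by rewrite /L /uscale mulrC divfK // expf_neq0 // pnatr_eq0 -lt0n ltnW.
have small k : k \in uclass I 1 -> util k <= 2 * L.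
  by move=> k1; rewrite ltW // -[2 * L]/(2 ^+ 1 * L) util_lt_uclass.
have card1 : #|uclass I 1|%:R <= n - 1.
  rewrite lerBrDr -[1]/(1%:R) -natrD ler_nat addn1 /ncust -cardsT.
  apply: proper_card; rewrite properE subsetT /=; apply/negP => all1.
  suff : umax I <= 2 * L.
    rewrite LE ler_pM2r // => nle; have : 4 <= n ^+ 2 by nra.
    lra.
  apply/bigmax_leP; split; first by lra.
  by move=> k _; apply: small; apply: (subsetP all1).
apply: le_trans (_ : 2 * L * #|uclass I 1|%:R <= _).
  by rewrite mulr_natr -sumr_const; apply: ler_sum.
apply: le_trans (_ : 2 * L * (n - 1) <= _); first by rewrite ler_wpM2l //; lra.
rewrite LE; have : 0 <= L * (n - 2) ^+ 2 by rewrite mulr_ge0 ?sqr_ge0 // ltW.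
by rewrite sqrrB; lra.
Qed.

(** The factor is [3 * c] for the counts times 2 for the spread of utilities. *)
Lemma class_ratio i P M :
    (1 < i)%N -> feas P -> greedy_alloc feas (uclass I i) M ->
  utility (P :&: uclass I i) <= 6 * c * utility M.
Proof.
move=> i1 fP gM; have L0 := uscale_gt0.
have MA : {subset M <= uclass I i}.
  by case: gM => s [ps _ ->] k /greedy_sub; rewrite (perm_mem ps) mem_enum.
have upper : utility (P :&: uclass I i) <= 2 ^+ i * L * #|P :&: uclass I i|%:R.
  rewrite mulr_natr -sumr_const; apply: ler_sum => k /setIP[_ ki].
  by apply/ltW/util_lt_uclass => //; apply: ltnW.
have lower : 2 ^+ i.-1 * L * #|M|%:R <= utility M.
  rewrite mulr_natr -sumr_const; apply: ler_sum => k kM.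
  by apply: util_ge_uclass => //; apply: MA.
have card := greedy_alloc_card gM fP.
apply: (le_trans upper).
apply: le_trans (_ : 2 ^+ i * L * (3 * c * #|M|%:R) <= _).
  by rewrite ler_wpM2l // mulr_ge0 ?exprn_ge0 // ltW.
have -> : 2 ^+ i * L * (3 * c * #|M|%:R) = 6 * c * (2 ^+ i.-1 * L * #|M|%:R).
  by case: i i1 {gM MA upper lower card} => // i _; rewrite exprS /=; ring.
by rewrite ler_wpM2l //; have := c_ge1; lra.
Qed.

(** The first class costs at most half of the optimum, so the remaining [3 * (ln n / ln 2)] classes
    at [6 * c] each count twice: 36 is [2 * 3 * 6]. *)
Lemma inelas_dem_alloc_approximates :
    umax I <= opt feas ->
  approximates (36 / ln 2 * c * ln n)^-1 feas (inelas_dem_alloc feas).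
Proof.
move=> umax_opt _ [Ms [i [gMs ci best ->]]].
split; first by case: (gMs i ci) => s [_ _ ->]; apply: greedy_feas.
have l2 := ln2_gt0; have c1 := c_ge1.
have ln0 : 0 < ln n by rewrite ln_gt0 // (lt_le_trans _ n_ge2) ?ltr1n.
have Mi0 : 0 <= utility (Ms i) by apply: sumr_ge0 => k _; rewrite ltW ?util_gt0.
rewrite mulrC ler_pdivrMr; last by rewrite !mulr_gt0 // ?invr_gt0 //; lra.
have Mi6 : 0 <= 6 * c * utility (Ms i) by rewrite !mulr_ge0 //; lra.
have bound P : feas P ->
    utility P <= umax I / 2 + N%:R * (6 * c * utility (Ms i)).
  move=> fP.
  rewrite /utility (partition_big (fun k => inord (level k) : 'I_N.+1) predT) //=.
  have lev k (j : 'I_N.+1) : (inord (level k) == j) = (level k == j).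
    by rewrite -val_eqE /= inordK // ltnS level_le.
  (* Level 0 is the first class, bounded without the greedy solution; level [j.+1] is class
     [j.+2]. *)
  rewrite big_ord_recl; apply: lerD.
    apply: le_trans uclass1_utility.
    apply: sum_util_le => k /andP[_]; rewrite lev => /eqP lk.
    by have := level_uclass k; rewrite lk.
  rewrite -[N in N%:R]card_ord mulr_natl -sumr_const; apply: ler_sum => j _.
  have cj : class_index I j.+2.
    split=> //; rewrite -nb_levelsE; have := ltn_ord j.
    by rewrite -[1]/(1%N%:Z) -PoszD lez_nat; lia.
  apply: le_trans (_ : utility (P :&: uclass I j.+2) <= _).
    apply: sum_util_le => k /andP[kP]; rewrite lev => /eqP lk.
    by have := level_uclass k; rewrite inE kP lk.
  apply: (le_trans (class_ratio (isT : (1 < j.+2)%N) fP (gMs _ cj))).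
  by rewrite ler_wpM2l ?best //; lra.
have : opt feas <= umax I / 2 + N%:R * (6 * c * utility (Ms i)).
  apply/bigmax_leP; split; last by move=> P /bound.
  by rewrite addr_ge0 //; [rewrite divr_ge0 // ltW // umax_gt0|rewrite mulr_ge0].
have : N%:R * (6 * c * utility (Ms i)) <= 3 * (ln n / ln 2) * (6 * c * utility (Ms i)).
  by rewrite ler_wpM2r // nb_levels_le.
have -> : utility (Ms i) * (36 / ln 2 * c * ln n)
  = 2 * (3 * (ln n / ln 2) * (6 * c * utility (Ms i))) by ring.
lra.
Qed.

End Greedy.

(** * Blocking by capacity and voltage constraints *)

Section Blocks.
Set Implicit Arguments.
Unset Strict Implicit.
Variables (R : realType) (I : instance R).
Implicit Types (A M : {set customer I}) (k : customer I) (e r v : node I).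

Lemma theta_ge k k' : `|carg (dem k) - carg (dem k')| <= theta I.
Proof. by apply: (bigmax_sup k) => //; apply: (bigmax_sup k'). Qed.

Lemma theta_zs_ge k e : e \in cpath k -> `|carg (dem k) - carg (imp e)| <= theta_zs I.
Proof. by move=> ke; apply: (bigmax_sup k) => //; apply: (bigmax_sup e). Qed.

Lemma pihalf_le_pi : pi / 2 <= pi :> R.
Proof. by have := pi_ge0 R; lra. Qed.

Lemma cos_pihalf_gt0 (x : R) : 0 <= x -> x < pi / 2 -> 0 < cos x.
Proof.
move=> x0 xpi; apply: cos_gt0_pihalf; rewrite xpi andbT.
by apply: lt_le_trans x0; rewrite oppr_lt0 divr_gt0 ?pi_gt0.
Qed.

Lemma capacity_ok_set0 : capacity_ok (set0 : {set customer I}).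
Proof.
apply/forallP => e; apply/implyP => er.
by rewrite big1 ?ComplexField.Normc.normc0 ?cap_ge0 // => k; rewrite inE.
Qed.

Lemma capacityP M :
  reflect (forall e, e != root_node I -> cmod (\sum_(k in M :&: below e) dem k) <= cap e)
          (capacity_ok M).
Proof.
apply: (iffP forallP) => h e; first move=> er; first move: (h e); rewrite ?er /=.
  by congr (cmod _ <= _); apply: eq_bigl => k; rewrite !inE.
apply/implyP => er; move: (h e er).
by congr (cmod _ <= _); apply: eq_bigl => k; rewrite !inE.
Qed.

(* Projecting the demands of [A] at the violated edge on the direction of
   [dem k] gives [|s_k| + cos theta * (rest of A) <= cap < |s_k| + (load of M)]. *)
Lemma capacity_blocks (c : R) : theta I < pi / 2 -> sec (theta I) <= c ->
  forall A M k, capacity_ok A -> capacity_ok M -> k \in A ->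
    ~~ capacity_ok (k |: M) ->
  exists e : node I, k \in below e /\
    mass (@demand_size R I) ((A :&: below e) :\ k)
    < c * mass (@demand_size R I) (M :&: below e).
Proof.
move=> th sc A M k okA okM kA /forallPn[e]; rewrite negb_imply => /andP[er].
rewrite -ltNge => over; exists e.
have th0 : 0 <= theta I by exact: le_trans (normr_ge0 _) (theta_ge k k).
have ct0 := cos_pihalf_gt0 th0 th.
have thpi : theta I <= pi by exact: le_trans (ltW th) pihalf_le_pi.
have {}okA := capacityP _ okA e er; have {}okM := capacityP _ okM e er.
have {}over : cap e < cmod (\sum_(j in (k |: M) :&: below e) dem j).
  move: over; congr (_ < cmod _); apply: eq_bigl => j; by rewrite !inE.
(* If [k] is already in [M], or is not below [e], adding it leaves the load at [e] unchanged and
   within the capacity. *)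
have [kM|kM] := boolP (k \in M).
  by move: over; rewrite (setUidPr _) ?sub1set // ltNge okM.
have [ke|ke] := boolP (k \in below e); last first.
  move: over; suff -> : (k |: M) :&: below e = M :&: below e by rewrite ltNge okM.
  rewrite setIUl (_ : [set k] :&: _ = set0) ?set0U //.
  by apply/eqP; rewrite setI_eq0 disjoints1.
split=> //.
have {}over : cap e < cmod (dem k + \sum_(j in M :&: below e) dem j).
  move: over; rewrite setIUl (setIidPl _) ?sub1set //.
  by rewrite big_setU1 // inE negb_and kM.
have d0 : 0 < cmod (dem k).
  rewrite lt_neqAle cmod_ge0 andbT; apply: contraTneq over => /esym.
  by move/ComplexField.Normc.eq0_normc ->; rewrite add0r -leNgt.
set B := A :&: below e in okA *; set D := M :&: below e in okM over *.
have kB : k \in B by rewrite inE kA.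
have lo : cmod (dem k) * (cmod (dem k)
            + cos (theta I) * mass (@demand_size R I) (B :\ k))
          <= cmod (dem k) * cmod (\sum_(j in B) dem j).
  apply: le_trans (_ : dot (\sum_(j in B) dem j) (dem k) <= _); last first.
    by rewrite mulrC dot_le.
  rewrite dot_suml (big_setD1 k) //= dotss mulrDr -expr2 lerD2l mulrA mulr_sumr.
  apply: ler_sum => j _.
  apply: le_trans (_ : cmod (dem j) * cmod (dem k) * cos (theta I) <= _).
    by rewrite /demand_size le_eqVlt; apply/orP; left; apply/eqP; ring.
  by apply: dot_ge => //; apply: theta_ge.
move: lo; rewrite ler_pM2l // => lo.
have hi : cap e < cmod (dem k) + mass (@demand_size R I) D.
  apply: (lt_le_trans over); apply: (le_trans (le_normcD _ _)).
  by rewrite lerD2l cmod_sum_le.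
have lt : cos (theta I) * mass (@demand_size R I) (B :\ k)
          < mass (@demand_size R I) D by lra.
apply: lt_le_trans (_ : sec (theta I) * mass (@demand_size R I) D <= _).
  by rewrite /sec mulrC ltr_pdivlMr // mulrC.
by rewrite ler_wpM2r // mass_ge0 //; apply: demand_size_ge0.
Qed.

(** The edge sought is the last node before the first arrival at the root. *)
Lemma top_edge e : e != root_node I ->
  exists2 r, r \in epath e & parent r = root_node I.
Proof.
move=> er.
have ex : exists m, iter m (@parent R I) e == root_node I.
  by exists (findex (@parent R I) e (root_node I)); rewrite iter_findex ?parent_connected.
case: (ex_minnP ex) => -[|m]; first by rewrite /= (negPf er).
move=> /= /eqP top min; exists (iter m (@parent R I) e) => //.
rewrite inE fconnect_iter andbT; apply/negP => /min.
by rewrite ltnn.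
Qed.

(** Of two edges on one path, one leads to the other, but from a top edge [parent] leads only to the
    root, where it stays. *)
Lemma top_edge_unique v r r' : r \in epath v -> r' \in epath v ->
  parent r = root_node I -> parent r' = root_node I -> r = r'.
Proof.
rewrite !inE => /andP[rr vr] /andP[rr' vr'] tr tr'.
have reach a b : b != root_node I -> parent a = root_node I ->
    fconnect (@parent R I) a b -> a = b.
  move=> br ta /iter_findex; case: (findex _ _ _) => [//|m].
  rewrite iterSr ta => bE; case/negP: br; rewrite -bE.
  by elim: m {bE} => //= m /eqP ->; rewrite parent_root.
by case/orP: (parent_connect_total vr vr') => /reach ->.
Qed.

Lemma cmod_imp_gt0 e : e != root_node I -> 0 < cmod (imp e).
Proof.
move=> er; rewrite lt_neqAle cmod_ge0 andbT; apply/eqP => /esym.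
move/ComplexField.Normc.eq0_normc => z0.
by have := imp_Re_gt0 er; rewrite z0 ltxx.
Qed.

Lemma rho_ge v e r : v != root_node I -> e \in epath v -> r \in epath v ->
  cmod (imp e) <= rho I * cmod (imp r).
Proof.
move=> vr ev rv; rewrite -ler_pdivrMr; last first.
  by apply: cmod_imp_gt0; move: rv; rewrite inE => /andP[].
by apply: (bigmax_sup v) => //; apply: (bigmax_sup e) => //; apply: (bigmax_sup r).
Qed.

Lemma rho_ge0 : 0 <= rho I.
Proof. exact: bigmax_ge_id. Qed.

(** The coefficient of the decision on [k] in the voltage constraint of [e], convertible to the
    inner sum of [voltage_ok]. *)
Definition voltage_coef k e : R :=
  \sum_(e' in cpath k :&: epath e) dot (imp e') (dem k).

Lemma voltageP M :
  reflect (forall e, e != root_node I -> \sum_(k in M) voltage_coef k e <= vbar I)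
          (voltage_ok M).
Proof.
by apply: (iffP forallP) => h e; [move=> er; have := h e; rewrite er|apply/implyP/h].
Qed.

Hypothesis thzs : theta_zs I < pi / 2.

Lemma theta_zs_ge0 : 0 <= theta_zs I.
Proof. exact: bigmax_ge_id. Qed.

Lemma dot_imp_ge k e : e \in cpath k ->
  cmod (imp e) * cmod (dem k) * cos (theta_zs I) <= dot (imp e) (dem k).
Proof.
move=> ke; rewrite dotC [cmod _ * cmod _]mulrC; apply: dot_ge; first exact: theta_zs_ge.
exact: le_trans (ltW thzs) pihalf_le_pi.
Qed.

Lemma dot_imp_ge0 k e : e \in cpath k -> 0 <= dot (imp e) (dem k).
Proof.
move=> /dot_imp_ge; apply: le_trans.
by rewrite !mulr_ge0 ?cmod_ge0 // ltW // cos_pihalf_gt0 ?theta_zs_ge0.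
Qed.

Lemma voltage_coef_ge0 k e : 0 <= voltage_coef k e.
Proof. by apply: sumr_ge0 => e' /setIP[/dot_imp_ge0]. Qed.

(** As [vbar I] may be negative, some feasible [M] is required; the coefficients are nonnegative. *)
Lemma voltage_ok_set0 M : voltage_ok M -> voltage_ok (set0 : {set customer I}).
Proof.
move=> /voltageP okM; apply/voltageP => e er; rewrite big_set0.
by apply: le_trans (okM e er); apply: sumr_ge0 => k _; apply: voltage_coef_ge0.
Qed.

Lemma voltage_coef_ge k e r : r \in cpath k -> r \in epath e ->
  cmod (imp r) * cos (theta_zs I) * demand_size k <= voltage_coef k e.
Proof.
move=> kr er; rewrite mulrAC; apply: (le_trans (dot_imp_ge kr)).
rewrite /voltage_coef (big_setD1 r) ?inE /=; last by move: kr er; rewrite !inE => -> ->.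
by rewrite lerDl sumr_ge0 // => e' /setD1P[_ /setIP[/dot_imp_ge0]].
Qed.

(** There are at most [eta_len I] terms, and [rho I] compares each impedance with that of [r], both
    edges being on the path of [e]. *)
Lemma voltage_coef_le k e r : e != root_node I -> r \in epath e ->
  voltage_coef k e <= cmod (imp r) * ((eta_len I)%:R * rho I) * demand_size k.
Proof.
move=> er re.
have eta : #|cpath k :&: epath e|%:R <= (eta_len I)%:R :> R.
  rewrite ler_nat; apply: leq_trans (subset_leq_card (subsetIr _ _)) _.
  exact: (leq_bigmax_cond (F := fun e => #|epath e|)).
apply: le_trans (_ : (rho I * cmod (imp r) * demand_size k)
                      * #|cpath k :&: epath e|%:R <= _).
  rewrite mulr_natr -sumr_const; apply: ler_sum => e' /setIP[_ ee'].
  by apply: (le_trans (dot_le _ _)); rewrite ler_wpM2r ?cmod_ge0 // (rho_ge er).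
have -> : cmod (imp r) * ((eta_len I)%:R * rho I) * demand_size k
          = rho I * cmod (imp r) * demand_size k * (eta_len I)%:R by ring.
by rewrite ler_wpM2l // !mulr_ge0 ?rho_ge0 ?cmod_ge0.
Qed.

(* A voltage constraint only sees the customers under one edge [r] at the root,
   and there all its coefficients are comparable with [|z_r| |s_k|]. *)
Lemma voltage_blocks (c : R) : (eta_len I)%:R * rho I * sec (theta_zs I) <= c ->
  forall A M k, voltage_ok A -> voltage_ok M -> k \in A ->
    ~~ voltage_ok (k |: M) ->
  exists e : node I, k \in below e /\
    mass (@demand_size R I) ((A :&: below e) :\ k)
    < c * mass (@demand_size R I) (M :&: below e).
Proof.
move=> hc A M k okA okM kA /forallPn[e]; rewrite negb_imply => /andP[er].
rewrite -ltNge -[X in _ < X]/(\sum_(j in k |: M) voltage_coef j e) => over.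
have {}okA := voltageP _ okA e er; have {}okM := voltageP _ okM e er.
have [kM|kM] := boolP (k \in M).
  by move: over; rewrite (setUidPr _) ?sub1set // ltNge okM.
rewrite big_setU1 //= in over.
(* Since [k] raises the voltage sum, its path shares an edge with that of [e]; [r] is the top edge
   above it. Any customer sharing an edge with [e] has the same top edge, by uniqueness on the path
   of [e]. *)
have [r re [kr top]] : exists2 r, r \in epath e &
    r \in cpath k /\ forall j, r \notin cpath j -> voltage_coef j e = 0.
  have [k0|[e' /setIP[ke' ee']]] := set_0Vmem (cpath k :&: epath e).
    by move: over; rewrite /voltage_coef k0 big_set0 add0r ltNge okM.
  have [r re' tr] : exists2 r, r \in epath e' & parent r = root_node I.
    by apply: top_edge; move: ee'; rewrite inE => /andP[].
  exists r; first exact: epath_trans re'.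
  split=> [|j rj]; first exact: epath_trans re'.
  apply: big1 => f /setIP[jf ef]; case/negP: rj.
  have [r' rf tr'] : exists2 r, r \in epath f & parent r = root_node I.
    by apply: top_edge; move: ef; rewrite inE => /andP[].
  rewrite (top_edge_unique (epath_trans ee' re') (epath_trans ef rf)) //.
  exact: epath_trans rf.
exists r; split; first by rewrite inE.
have rr : r != root_node I by move: re; rewrite inE => /andP[].
have zr := cmod_imp_gt0 rr.
have ct := cos_pihalf_gt0 theta_zs_ge0 thzs.
have MB : \sum_(j in M) voltage_coef j e = \sum_(j in M :&: below r) voltage_coef j e.
  rewrite (big_setID (below r)) /= [X in _ + X]big1 ?addr0 // => j /setDP[_].
  by rewrite inE => /top.
(* The coefficient of [k] cancels between the bound for [A] and the violation by [k |: M]; the terms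
   of [A] not below [r] are dropped. *)
have lt : \sum_(j in (A :&: below r) :\ k) voltage_coef j e
          < \sum_(j in M :&: below r) voltage_coef j e.
  have le : \sum_(j in (A :&: below r) :\ k) voltage_coef j e
       <= \sum_(j in A :\ k) voltage_coef j e.
    have sub : (A :&: below r) :\ k \subset A :\ k by rewrite setSD ?subsetIl.
    rewrite [leRHS](big_setID ((A :&: below r) :\ k)) /= (setIidPr sub) lerDl.
    by apply: sumr_ge0 => j _; apply: voltage_coef_ge0.
  by move: okA; rewrite (big_setD1 k) //= -MB => okA; lra.
have lo : cmod (imp r) * cos (theta_zs I)
            * mass (@demand_size R I) ((A :&: below r) :\ k)
          <= \sum_(j in (A :&: below r) :\ k) voltage_coef j e.
  rewrite mulr_sumr; apply: ler_sum => j /setD1P[_ /setIP[_]]; rewrite inE => jr.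
  exact: voltage_coef_ge.
have hi : \sum_(j in M :&: below r) voltage_coef j e
    <= cmod (imp r) * ((eta_len I)%:R * rho I)
       * mass (@demand_size R I) (M :&: below r).
  by rewrite mulr_sumr; apply: ler_sum => j _; apply: voltage_coef_le.
have := le_lt_trans lo (lt_le_trans lt hi); rewrite -!mulrA ltr_pM2l // => {}lt.
apply: lt_le_trans (_ : (eta_len I)%:R * rho I * sec (theta_zs I)
   * mass (@demand_size R I) (M :&: below r) <= _).
  by rewrite /sec mulrAC ltr_pdivlMr // mulrC -mulrA.
by rewrite ler_wpM2r // mass_ge0 //; apply: demand_size_ge0.
Qed.

Lemma both_blocks (c : R) : theta I < pi / 2 -> sec (theta I) <= c ->
    (eta_len I)%:R * rho I * sec (theta_zs I) <= c ->
  forall A M k, both_ok A -> both_ok M -> k \in A -> ~~ both_ok (k |: M) ->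
  exists e : node I, k \in below e /\
    mass (@demand_size R I) ((A :&: below e) :\ k)
    < c * mass (@demand_size R I) (M :&: below e).
Proof.
move=> th sc hc A M k /andP[cA vA] /andP[cM vM] kA; rewrite negb_and => /orP[].
  exact: capacity_blocks.
exact: voltage_blocks.
Qed.

Lemma eta_len_gt0 k : (0 < eta_len I)%N.
Proof.
have kr := loc_neq_root k.
apply: leq_trans (_ : #|epath (loc k)| <= _)%N; last first.
  exact: (leq_bigmax_cond (F := fun e => #|epath e|)).
by apply/card_gt0P; exists (loc k); rewrite epath_refl.
Qed.

End Blocks.

(** * The three approximation ratios *)

Lemma opt_gt0_feasible (R : realType) (I : instance R) (feas : pred {set customer I}) :
  0 < opt feas -> exists M, feas M.
Proof.
move=> o0; case: (pickP feas) => [M fM|no]; first by exists M.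
by move: o0; rewrite /opt big_pred0 // ltxx.
Qed.

Theorem theorem7 (R : realType) (rho0 sec0 seczs0 : R) :
  [/\ exists2 K : R, 0 < K & forall I : instance R,
        rho I <= rho0 -> sec (theta I) <= sec0 -> sec (theta_zs I) <= seczs0 ->
        theta I < pi / 2 -> theta_zs I < pi / 2 ->
        (1 < ncust I)%N -> umax I <= opt (@capacity_ok R I) ->
        approximates (K * ln (ncust I)%:R)^-1 (@capacity_ok R I)
          (inelas_dem_alloc (@capacity_ok R I)),
      exists2 K : R, 0 < K & forall I : instance R,
        rho I <= rho0 -> sec (theta I) <= sec0 -> sec (theta_zs I) <= seczs0 ->
        theta I < pi / 2 -> theta_zs I < pi / 2 ->
        (1 < ncust I)%N -> umax I <= opt (@voltage_ok R I) ->
        approximates (K * (eta_len I)%:R * ln (ncust I)%:R)^-1 (@voltage_ok R I)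
          (inelas_dem_alloc (@voltage_ok R I))
    & exists2 K : R, 0 < K & forall I : instance R,
        rho I <= rho0 -> sec (theta I) <= sec0 -> sec (theta_zs I) <= seczs0 ->
        theta I < pi / 2 -> theta_zs I < pi / 2 ->
        (1 < ncust I)%N -> umax I <= opt (@both_ok R I) ->
        approximates (K * (eta_len I)%:R * ln (ncust I)%:R)^-1 (@both_ok R I)
          (inelas_dem_alloc (@both_ok R I))].
Proof.
(* [C] dominates both [sec (theta I)] and [rho I * sec (theta_zs I)]; absolute values keep it at
   least 1 for arbitrary real bounds. *)
pose C : R := 1 + `|sec0| + `|rho0 * seczs0|.
have C1 : 1 <= C by rewrite /C -addrA lerDl addr_ge0.
have K0 : 0 < 36 / ln 2 * C.
  by rewrite mulr_gt0 ?divr_gt0 ?ln2_gt0 //; apply: lt_le_trans C1.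
have secC (I : instance R) : sec (theta I) <= sec0 -> sec (theta I) <= C.
  move/le_trans; apply; rewrite /C addrAC; apply: (le_trans (ler_norm _)).
  by rewrite lerDr addr_ge0.
have eta1 (I : instance R) : (1 < ncust I)%N -> 1 <= (eta_len I)%:R :> R.
  by move=> /ltnW /card_gt0P[k _]; rewrite ler1n (eta_len_gt0 k).
have zsC (I : instance R) : rho I <= rho0 -> sec (theta_zs I) <= seczs0 ->
    theta_zs I < pi / 2 ->
    (eta_len I)%:R * rho I * sec (theta_zs I) <= C * (eta_len I)%:R.
  move=> hr hs hzs; rewrite -mulrA mulrC ler_wpM2r //.
  apply: le_trans (_ : rho0 * seczs0 <= _).
    apply: ler_pM => //; first exact: rho_ge0.
    by rewrite invr_ge0 ltW // cos_pihalf_gt0 // theta_zs_ge0.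
  by apply: (le_trans (ler_norm _)); rewrite /C lerDr addr_ge0.
have etaC (I : instance R) : (1 < ncust I)%N -> C <= C * (eta_len I)%:R.
  by move=> n1; rewrite ler_peMr ?eta1 //; apply: le_trans C1.
(* [opt] is 0 when nothing is feasible, so [umax I > 0] yields a feasible set, from which the empty
   set inherits the voltage constraint. *)
have feas (I : instance R) (ok : pred {set customer I}) :
    (1 < ncust I)%N -> umax I <= opt ok -> exists M, ok M.
  by move=> n1 hu; apply: opt_gt0_feasible; apply: lt_le_trans hu; apply: umax_gt0.
(* One [K] serves all three parts: [c] is [C] for capacities and [C * (eta_len I)%:R] when voltages
   occur. *)
split; exists (36 / ln 2 * C) => // I hr hs hzs th thzs n1 hu.
- apply: inelas_dem_alloc_approximates => //; first exact: capacity_ok_set0.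
  exact: (capacity_blocks _ (secC _ hs)).
- have [M okM] := feas I _ n1 hu.
  rewrite -[_ * C * _]mulrA; apply: inelas_dem_alloc_approximates => //.
  + exact: le_trans (etaC _ n1).
  + exact: voltage_ok_set0 okM.
  + exact: (voltage_blocks _ (zsC _ _ _ _)).
- have [M /andP[_ okM]] := feas I _ n1 hu.
  rewrite -[_ * C * _]mulrA; apply: inelas_dem_alloc_approximates => //.
  + exact: le_trans (etaC _ n1).
  + by rewrite /both_ok capacity_ok_set0 (voltage_ok_set0 thzs okM).
  + apply: both_blocks => //; last exact: zsC.
    exact: le_trans (secC _ hs) (etaC _ n1).
Qed.
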